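(* The privacy-preserving cake-cutting protocol PP\_CC\_puv described in the context is strategyproof for agents with piecewise uniform valuations. That is, for every agent $A_i$, every true piecewise uniform valuation $v_i$ of $A_i$, every (piecewise uniform) reports $\hat v_{-i}$ of the other agents, and every piecewise uniform misreport $\hat v_i$ of $A_i$, if $P_i$ denotes the piece allocated to $A_i$ by the protocol when $A_i$ reports $v_i$ truthfully and $\hat P_i$ denotes the piece allocated to $A_i$ when it reports $\hat v_i$ (others reporting $\hat v_{-i}$ in both cases), then $v_i(P_i)\ge v_i(\hat P_i)$.
   Context: The cake is $C=[0,1]$, to be divided among agents $A_1,\dots,A_n$. Each agent $A_i$ has a valuation $v_i:C\to[0,\infty)$ that is a probability density, and a piece $X\subseteq C$ has value $v_i(X)=\int_X v_i(x)\,dx$. A valuation $v$ is piecewise uniform if there are $\ell\ge 1$ disjoint intervals $I_1,\dots,I_\ell\subseteq C$ with union $B$ such that $v(x)=c$ on $B$ with $c=(\sum_j |I_j|)^{-1}$ and $v(x)=0$ on $C\setminus B$; support endpoints are assumed to be finite decimals (so they are represented exactly after scaling by a common power of $10$). Protocol PP\_CC\_puv: each agent reports (via secret sharing) a number $\ell_i$ of support intervals and a sorted list of support intervals $[a_{i,j},b_{i,j})$, $j=1,\dots,L$ for a public bound $L$, padded with empty intervals for $j>\ell_i$; reports not of this valid form are detected and the execution aborts. The protocol computes $\ell=\max_i \ell_i$ and discards intervals with index $j>\ell$. It then securely computes, and reveals to each agent its own piece, exactly the allocation produced by the following algorithm CC\_puv on the reported valuations. Algorithm CC\_puv: the endpoints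 of all reported support intervals, together with $0$ and $1$, partition $C$ into a set $\mathcal W$ of intervals. For a set $S$ of agents and $X\subseteq\mathcal W$, an interval $I\in X$ is desired by $S$ if $I$ has positive length and is contained in the support of some agent in $S$; $D(S,X)$ is the set of intervals of $X$ desired by $S$, $\mathrm{Len}(S,X)$ is their total length, and $\mathrm{avg}(S,X)=\mathrm{Len}(S,X)/|S|$. Start with $S=\{A_1,\dots,A_n\}$ and $X=\mathcal W$. While $S\neq\emptyset$: choose (by a fixed deterministic tie-breaking rule) a nonempty $S'\subseteq S$ minimizing $\mathrm{avg}(S',X)$; build the directed graph with a source, a node for each interval $I\in X$ (edge from the source of capacity $|I|$), a node for each agent in $S'$ (edge from interval node $I$ to agent node of capacity $|I|$ whenever that agent desires $I$), and a target (edge from each agent node of capacity $\mathrm{avg}(S',X)$); compute (by a fixed deterministic rule) a maximum flow, which has value $\mathrm{Len}(S',X)$, and give each agent in $S'$, from each interval $I\in D(S',X)$, a subinterval of $I$ of length equal to the flow on the edge from $I$ to that agent (the subintervals of each $I$ being disjoint), so each agent of $S'$ receives total length $\mathrm{avg}(S',X)$ of intervals it desires; then set $S\leftarrow S\setminus S'$ and $X\leftarrow X\setminus D(S',X)$. *)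

(* Defs.v *)
From HB Require Import structures.
From mathcomp Require Import all_boot all_order all_algebra.
From mathcomp Require Import boolp reals.

Set Implicit Arguments.
Unset Strict Implicit.
Unset Printing Implicit Defensive.

Import Order.TTheory GRing.Theory Num.Theory.
Local Open Scope ring_scope.

Section CC.
Variables (R : realType) (n : nat).

(* An interval [a, b) is represented by the pair (a, b). *)
Definition ilen (iv : R * R) : R := iv.2 - iv.1.

Definition overlap (J iv : R * R) : R :=
  Num.max 0 (Num.min J.2 iv.2 - Num.max J.1 iv.1).

(* A reported profile: the list of support intervals of each agent. *)
Definition profile := 'I_n -> seq (R * R).

Definition in_supp (B : seq (R * R)) (x : R) : bool :=
  has (fun iv => (iv.1 <= x) && (x < iv.2)) B.

Definition cuts (v : profile) : seq R :=
  sort <=%R (undup (0 :: 1 :: flatten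
    [seq flatten [seq [:: iv.1; iv.2] | iv <- v j] | j <- enum 'I_n])).

Definition Wint (v : profile) : seq (R * R) :=
  let ps := cuts v in zip ps (behead ps).

Definition Wk (v : profile) (k : nat) : R * R := nth (0, 0) (Wint v) k.

Definition desires (v : profile) (j : 'I_n) (iv : R * R) : bool :=
  `[< iv.1 < iv.2 /\ forall x, iv.1 <= x -> x < iv.2 -> in_supp (v j) x >].

Definition desiredby (v : profile) (S : {set 'I_n}) (iv : R * R) : bool :=
  `[< exists2 j, j \in S & desires v j iv >].

(* Sub-collections X of W are predicates on indices k < size (Wint v). *)
Definition D (v : profile) (S : {set 'I_n}) (X : nat -> bool) (k : nat) : bool :=
  [&& (k < size (Wint v))%N, X k & desiredby v S (Wk v k)].

Definition Len (v : profile) (S : {set 'I_n}) (X : nat -> bool) : R :=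
  \sum_(k < size (Wint v) | D v S X k) ilen (Wk v k).

Definition avg (v : profile) (S : {set 'I_n}) (X : nat -> bool) : R :=
  Len v S X / (#|S|%:R).

(* A flow in the network of the context: f k j is the flow on the edge from
   interval node k to agent node j; the source->interval and agent->target
   flows are then determined by conservation. *)
Definition is_flow (v : profile) (S' : {set 'I_n}) (X : nat -> bool)
    (f : nat -> 'I_n -> R) : Prop :=
  [/\ (forall k j, 0 <= f k j),
      (forall k j, f k j != 0 ->
         [/\ (k < size (Wint v))%N, X k, j \in S' & desires v j (Wk v k)]),
      (forall k j, f k j <= ilen (Wk v k)),
      (forall k, \sum_j f k j <= ilen (Wk v k)) &
      (forall j, \sum_(k < size (Wint v)) f k j <= avg v S' X)].

Definition flow_value (v : profile) (f : nat -> 'I_n -> R) : R :=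
  \sum_(k < size (Wint v)) \sum_j f k j.

Definition is_maxflow v S' X f : Prop :=
  is_flow v S' X f /\ forall g, is_flow v S' X g -> flow_value v g <= flow_value v f.

Definition valid_place (v : profile) (f : nat -> 'I_n -> R)
    (p : nat -> 'I_n -> R * R) : Prop :=
  forall k, (k < size (Wint v))%N ->
    (forall j, [/\ (Wk v k).1 <= (p k j).1, (p k j).2 <= (Wk v k).2
                 & ilen (p k j) = f k j]) /\
    (forall j j', j != j' ->
       [\/ (p k j).2 <= (p k j').1, (p k j').2 <= (p k j).1,
           (p k j).1 = (p k j).2 | (p k j').1 = (p k j').2]).

(* The fixed deterministic rules used by CC_puv: choice of S', of the maximum
   flow, and of the placement of the subintervals. They are deterministic
   functions of the reported profile and of the current state (S, X). *)
Record CCrules := {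
  rchoose : profile -> {set 'I_n} -> (nat -> bool) -> {set 'I_n};
  rflow : profile -> {set 'I_n} -> (nat -> bool) -> nat -> 'I_n -> R;
  rplace : profile -> {set 'I_n} -> (nat -> bool) -> nat -> 'I_n -> R * R }.

Definition valid_rules (ru : CCrules) : Prop :=
  forall (v : profile) (S : {set 'I_n}) (X : nat -> bool), S != set0 ->
    let S' := rchoose ru v S X in
    [/\ S' != set0, S' \subset S,
        (forall T : {set 'I_n}, T != set0 -> T \subset S -> avg v S' X <= avg v T X),
        is_maxflow v S' X (rflow ru v S X) &
        valid_place v (rflow ru v S X) (rplace ru v S X)].

(* State of CC_puv: remaining agents S, remaining intervals X, allocation. *)
Definition CCstate := ({set 'I_n} * (nat -> bool) * ('I_n -> seq (R * R)))%type.

Definition CC_step (ru : CCrules) (v : profile) (st : CCstate) : CCstate :=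
  let: (Sr, X, alloc) := st in
  if Sr == set0 then st else
  let S' := rchoose ru v Sr X in
  let p := rplace ru v Sr X in
  ((Sr :\: S')%SET, (fun k => X k && ~~ D v S' X k),
   (fun j => if j \in S' then [seq p k j | k <- iota 0 (size (Wint v)) & D v S' X k]
             else alloc j)).

(* Each round removes at least one agent, so n rounds suffice. *)
Definition CC_puv (ru : CCrules) (v : profile) : 'I_n -> seq (R * R) :=
  (iter n (CC_step ru v) ([set: 'I_n], (fun _ => true), (fun _ => [::]))).2.

(* Reports of the protocol: (l_i, list of L intervals [a, b)). *)
Definition report := (nat * seq (R * R))%type.

Definition is_decimal (x : R) : Prop :=
  exists (k : nat) (z : int), x = z%:~R / 10%:R ^+ k.

Definition valid_report (L : nat) (r : report) : Prop :=
  let ints := r.2 in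
  [/\ (1 <= r.1 <= L)%N /\ size ints = L,
      (forall k, (k < r.1)%N ->
         0 <= (nth (0, 0) ints k).1 /\ (nth (0, 0) ints k).1 < (nth (0, 0) ints k).2
         /\ (nth (0, 0) ints k).2 <= 1),
      (forall k, (k.+1 < r.1)%N -> (nth (0, 0) ints k).2 <= (nth (0, 0) ints k.+1).1),
      (forall k, (r.1 <= k < L)%N ->
         0 <= (nth (0, 0) ints k).1 /\ (nth (0, 0) ints k).1 = (nth (0, 0) ints k).2
         /\ (nth (0, 0) ints k).2 <= 1) &
      (forall iv, iv \in ints -> is_decimal iv.1 /\ is_decimal iv.2)].

Definition supp_of (r : report) : seq (R * R) := take r.1 r.2.

(* v(P) = int_P v for the piecewise uniform valuation v described by r,
   P a finite union of pairwise disjoint intervals [a, b). *)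
Definition pu_value (r : report) (P : seq (R * R)) : R :=
  (\sum_(J <- P) \sum_(iv <- supp_of r) overlap J iv) / \sum_(iv <- supp_of r) ilen iv.

Definition PP_CC_puv (ru : CCrules) (rep : 'I_n -> report) : 'I_n -> seq (R * R) :=
  let l := \max_(j : 'I_n) (rep j).1 in
  CC_puv ru (fun j => take l (rep j).2).

End CC.

(* Main.v *)
Require Import Defs.
From HB Require Import structures.
From mathcomp Require Import all_boot all_order all_algebra.
From mathcomp Require Import boolp reals.
From mathcomp Require Import lra.
Import Order.TTheory GRing.Theory Num.Theory.
Local Open Scope ring_scope.

(* Let u_j be the length agent j receives under truthful reports, and z_j the
   truly useful length it receives when agent i misreports. For a set A of
   agents, sums of u or z over A are at most the measure cap(A) of the union of
   the true supports of A. CC_puv exhausts the supports of the agents served up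
   to any given average, so cap(A) is attained by u on every sublevel set of u,
   and by z on every sublevel set of z below z_i, where A omits i and its misreport
   plays no role. These two tightness properties force z_i <= u_i.
   Reports with different endpoints are compared by integrating indicator
   functions over a common sorted list of breakpoints. *)

Set Implicit Arguments.
Unset Strict Implicit.
Unset Printing Implicit Defensive.

(** * Comparing two vectors through tight sublevel sets *)

Lemma ltr_sum_set (R : realDomainType) (T : finType) (A : {set T}) (u z : T -> R)
    (j : T) :
  j \in A -> u j < z j -> {in A, forall k, u k <= z k} ->
  \sum_(k in A) u k < \sum_(k in A) z k.
Proof.
move=> jA lt_uz le_uz; rewrite (bigD1 j) //= [ltRHS](bigD1 j) //=.
by apply: ltr_leD => //; apply: ler_sum => k /andP[/le_uz].
Qed.

(* Look at the least value of [min (u k) (z k)] over the [k] with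
   [u k != z k]: whichever of [u], [z] attains it, the corresponding sublevel
   set is tight for it and overfull for the other. *)
Lemma level_tight_le (R : realDomainType) (T : finType) (cap : {set T} -> R)
    (u z : T -> R) (i : T) :
  (forall A : {set T}, \sum_(j in A) u j <= cap A) ->
  (forall A : {set T}, \sum_(j in A) z j <= cap A) ->
  (forall c, cap [set j | u j <= c] <= \sum_(j in [set j | u j <= c]) u j) ->
  (forall c, c < z i ->
     cap [set j | z j <= c] <= \sum_(j in [set j | z j <= c]) z j) ->
  z i <= u i.
Proof.
move=> cap_u cap_z tight_u tight_z; rewrite leNgt; apply/negP => lt_uz.
have [j neq_j min_j] : exists2 j, u j != z j & forall k, u k != z k ->
    Num.min (u j) (z j) <= Num.min (u k) (z k).
  have neq_i : u i != z i by rewrite lt_eqF.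
  have [j ? ?] := Order.TotalTheory.arg_minP (P := fun k => u k != z k)
    (fun k => Num.min (u k) (z k)) neq_i.
  by exists j.
have := min_j i; rewrite (lt_eqF lt_uz) => /(_ isT).
rewrite [leRHS](min_l (ltW lt_uz)) => le_i.
case: (ltgtP (u j) (z j)) neq_j => // lt_j _.
- rewrite (min_l (ltW lt_j)) in le_i min_j.
  (* On the sublevel set of [u] at [u j], an index where [u] and [z] differ has [u k <= u j <= z k]
     by minimality, so [z] sums to strictly more than the capacity allows. *)
  have := le_trans (cap_z _) (tight_u (u j)); rewrite leNgt => /negP; apply.
  apply: (ltr_sum_set (j := j)) => //; first by rewrite inE.
  move=> k; rewrite inE => le_k; have [->//|/min_j] := eqVneq (u k) (z k).
  by rewrite le_min => /andP[_]; apply: le_trans.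
- rewrite (min_r (ltW lt_j)) in le_i min_j.
  (* Tightness of [z] is available at this level: [z j] is the minimum, so [z j <= u i < z i]. *)
  have := le_trans (cap_u _) (tight_z (z j) (le_lt_trans le_i lt_uz)).
  rewrite leNgt => /negP; apply.
  apply: (ltr_sum_set (j := j)) => //; first by rewrite inE.
  move=> k; rewrite inE => le_k; have [->//|/min_j] := eqVneq (u k) (z k).
  by rewrite le_min => /andP[+ _]; apply: le_trans.
Qed.

(** * Integration of step functions over a sorted list *)

(* The integral of [f], provided that the breakpoints of [f] lie in the sorted
   list [s] and that [f] is right-continuous and vanishes outside the range of [s]. *)
Fixpoint stepint (R : numDomainType) (s : seq R) (f : R -> R) : R :=
  if s is a :: s' then
    (if s' is b :: _ then f a * (b - a) else 0) + stepint s' f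
  else 0.

Lemma stepint_sum (R : numDomainType) (I : Type) (r : seq I) (P : pred I)
    (s : seq R) (f : I -> R -> R) :
  \sum_(i <- r | P i) stepint s (f i) =
  stepint s (fun x => \sum_(i <- r | P i) f i x).
Proof.
elim: s => [|a [|b s] IH] /=; first by rewrite big1.
  by rewrite big1 ?addr0 // => i _; rewrite addr0.
by rewrite big_split /= mulr_suml IH.
Qed.

Lemma stepint_le (R : numDomainType) (s : seq R) (f g : R -> R) :
  sorted <=%R s -> (forall x, f x <= g x) -> stepint s f <= stepint s g.
Proof.
move=> + le_fg; elim: s => [|a [|b s] IH] //= /andP[le_ab /IH le_s].
by apply: lerD; rewrite // ler_wpM2r ?subr_ge0.
Qed.

Lemma stepint_eq (R : numDomainType) (s : seq R) (f g : R -> R) :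
  f =1 g -> stepint s f = stepint s g.
Proof. by move=> eq_fg; elim: s => [|a [|b s] /= IH] //=; rewrite eq_fg IH. Qed.

Lemma stepint0 (R : numDomainType) (s : seq R) : stepint s (fun=> 0) = 0.
Proof. by elim: s => [|a [|b s] /= IH] //=; rewrite ?mul0r add0r. Qed.

Lemma stepint_ltr0 (R : realDomainType) (a : R) (s : seq R) :
  all (>= a) s -> stepint s (fun x => (x < a)%R%:R) = 0.
Proof.
elim: s => [|b [|c s] /= IH] //=; first by rewrite addr0.
by case/andP => le_ab /IH ->; rewrite ltNge le_ab mul0r addr0.
Qed.

Lemma stepint_ltr (R : realDomainType) (a b : R) (s : seq R) :
  path <=%R a s -> b \in a :: s ->
  stepint (a :: s) (fun x => (x < b)%R%:R) = b - a.
Proof.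
elim: s a => [|c s IH] a; first by rewrite inE => _ /eqP->; rewrite /= subrr addr0.
move=> Hacs; rewrite inE => /orP[/eqP->|bs].
  rewrite subrr; apply: stepint_ltr0.
  by apply/andP; split=> //; apply: order_path_min Hacs; apply: le_trans.
have /andP[le_ac Hs] := Hacs.
have le_cb : c <= b.
  by move: bs; rewrite inE => /orP[/eqP->//|]; apply: (allP (order_path_min le_trans Hs)).
rewrite /=; have /= -> := IH c Hs bs; have [lt_ab|] := ltP a b.
  by rewrite mul1r addrC subrKA.
(* Here [c <= b <= a <= c]: the breakpoint is repeated and the first step has length zero. *)
by move=> le_ba; have -> : c = a; [lra | rewrite mul0r add0r].
Qed.

Definition mem_ivl (R : numDomainType) (x : R) (J : R * R) : bool :=
  (J.1 <= x) && (x < J.2).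

(** The indicator of [x < J.2] is the sum of the indicators of [x < J.1] and of [J], so the length
    is a difference of two initial segments. Additivity comes from [stepint_sum] over a list of two
    booleans. *)
Lemma stepint_ivl (R : realType) (s : seq R) (J : R * R) :
  sorted <=%R s -> J.1 \in s -> J.2 \in s -> J.1 <= J.2 ->
  stepint s (fun x => (mem_ivl x J)%:R) = ilen J.
Proof.
case: s => // a s Hs J1 J2 le_J.
apply/(@addIr _ (stepint (a :: s) (fun x => (x < J.1)%R%:R))).
rewrite [in RHS]stepint_ltr // /ilen addrC.
have -> : J.2 - J.1 + (J.1 - a) = J.2 - a by lra.
rewrite -(@stepint_ltr _ _ _ s) //.
have := @stepint_sum R _ [:: true; false] xpredT (a :: s)
  (fun b x => if b then (x < J.1)%R%:R else (mem_ivl x J)%:R).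
rewrite !big_cons !big_nil addr0 => ->; apply: stepint_eq => x.
rewrite !big_cons big_nil addr0 /mem_ivl ltNge -natrD.
case: (leP J.1 x) => //= lt_x; rewrite (lt_le_trans lt_x le_J) //.
Qed.

(** * Maximum flows saturate the chosen agents *)

(** Both perturbations of a maximum flow made below alter only the flow leaving one interval
    node. *)
Definition set_row (R : Type) (I : Type) (f : nat -> I -> R) (k : nat) (r : I -> R) :
  nat -> I -> R := fun k' => if k' == k then r else f k'.

(** [F] is evaluation at an agent for the inflow of that agent, and the sum over all agents for the
    flow value. *)
Lemma sum_set_row (R : zmodType) (I : Type) (m k : nat) (f : nat -> I -> R)
    (r : I -> R) (F : (I -> R) -> R) :
  (k < m)%N ->
  \sum_(k' < m) F (set_row f k r k') = \sum_(k' < m) F (f k') - F (f k) + F r.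
Proof.
move=> lt_k; rewrite (bigD1 (Ordinal lt_k)) //= [in RHS](bigD1 (Ordinal lt_k)) //=.
rewrite {1}/set_row eqxx [F (f k) + _]addrC addrK addrC; congr (_ + _).
by apply: eq_bigr => k' /negPf; rewrite /set_row -val_eqE /= => ->.
Qed.

Lemma is_flow_set_row (R : realType) (n : nat) (v : profile R n) (S : {set 'I_n})
    (X : nat -> bool) (f : nat -> 'I_n -> R) (k : nat) (r : 'I_n -> R) :
  is_flow v S X f -> (k < size (Wint v))%N -> X k ->
  (forall j, 0 <= r j) ->
  (forall j, r j != 0 -> j \in S /\ desires v j (Wk v k)) ->
  \sum_j r j <= ilen (Wk v k) ->
  (forall j, \sum_(k' < size (Wint v)) f k' j - f k j + r j <= avg v S X) ->
  is_flow v S X (set_row f k r).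
Proof.
move=> [f_ge0 f_supp f_le f_row f_col] lt_k Xk r_ge0 r_supp r_row r_col.
rewrite /set_row; split=> [k' j|k' j|k' j|k'|j].
- by case: (k' =P k).
- by case: (k' =P k) => [->|_]; [case/r_supp | apply: f_supp].
- case: (k' =P k) => [->|_] //; apply: le_trans r_row.
  by rewrite (bigD1 j) //= lerDl sumr_ge0.
- by case: (k' =P k) => [->|_].
- have /= := sum_set_row f r (fun r => r j) lt_k.
  by rewrite /set_row => ->.
Qed.

Lemma flow_value_set_row (R : realType) (n : nat) (v : profile R n)
    (f : nat -> 'I_n -> R) (k : nat) (r : 'I_n -> R) :
  (k < size (Wint v))%N ->
  flow_value v (set_row f k r) = flow_value v f - \sum_j f k j + \sum_j r j.
Proof. by move=> lt_k; apply: (sum_set_row f r (fun r => \sum_j r j)). Qed.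

Lemma sum_delta (R : pzRingType) (T : finType) (j : T) (e : R) :
  \sum_t (t == j)%:R * e = e.
Proof.
rewrite (bigD1 j) //= eqxx mul1r big1 ?addr0 // => t /negPf->.
by rewrite mul0r.
Qed.

(** There may be infinitely many maximum flows, but the quantity maximized is a natural number
    bounded by [n]. *)
Lemma maxflow_extremal (R : realType) (n : nat) (v : profile R n) (S : {set 'I_n})
    (X : nat -> bool) (f : nat -> 'I_n -> R)
    (U : (nat -> 'I_n -> R) -> {set 'I_n}) :
  is_maxflow v S X f ->
  exists2 g, is_maxflow v S X g &
    (#|U f| <= #|U g|)%N /\ forall h, is_maxflow v S X h -> (#|U h| <= #|U g|)%N.
Proof.
move=> max_f.
pose P m := `[< exists2 g, is_maxflow v S X g & #|U g| = m >].
have exP : exists m, P m by exists #|U f|; apply/asboolP; exists f.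
have leP m : P m -> (m <= n)%N.
  by move/asboolP => [g _ <-]; rewrite -[leqRHS]card_ord max_card.
have [m /asboolP[g max_g <-] Hg] := ex_maxnP exP leP.
exists g => //; split=> [|h max_h]; apply: Hg; apply/asboolP.
  by exists f.
by exists h.
Qed.

(* Among the maximum flows take one with the largest set [T] of unsaturated
   agents: an interval desired by [T] has no spare length and gives nothing
   outside [T], so [Len T < #|T| * avg S]. *)
Lemma maxflow_saturates (R : realType) (n : nat) (v : profile R n) (S : {set 'I_n})
    (X : nat -> bool) (f : nat -> 'I_n -> R) :
  is_maxflow v S X f ->
  (forall T : {set 'I_n}, T != set0 -> T \subset S -> avg v S X <= avg v T X) ->
  forall j, j \in S -> \sum_(k < size (Wint v)) f k j = avg v S X.
Proof.
move=> max_f min_S j0 Sj0; apply/eqP; rewrite eq_le.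
have [_ _ _ _ ->] /= := max_f.1; rewrite leNgt; apply/negP => lt_j0.
pose U (g : nat -> 'I_n -> R) :=
  [set j in S | \sum_(k < size (Wint v)) g k j < avg v S X].
have [g [flow_g max_g] [Uf_le Ug_max]] := maxflow_extremal U max_f.
have [g_ge0 g_supp g_le g_row g_col] := flow_g.
set T := U g in Uf_le Ug_max.
have T0 : T != set0.
  by rewrite -card_gt0 (leq_trans _ Uf_le) // card_gt0; apply/set0Pn; exists j0;
     rewrite inE Sj0.
have TS : T \subset S by apply/subsetP => j; rewrite inE => /andP[].
have slack j : j \in T -> 0 < avg v S X - \sum_(k < size (Wint v)) g k j.
  by rewrite inE subr_gt0 => /andP[].
have row_full k : D v T X k -> \sum_(j in T) g k j = ilen (Wk v k).
  case/and3P => lt_k Xk /asboolP[j Tj des_j].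
  have Sj := subsetP TS _ Tj.
  have full : \sum_t g k t = ilen (Wk v k).
    apply/eqP; rewrite eq_le g_row leNgt; apply/negP => lt_row.
    (* With spare length in [k], the flow from [k] to the unsaturated agent [j] can grow by [e], the
       smaller of the two residual capacities, against maximality of [g]. *)
    pose e := Num.min (avg v S X - \sum_(k < size (Wint v)) g k j)
                      (ilen (Wk v k) - \sum_t g k t).
    have e_gt0 : 0 < e by rewrite lt_min slack //= subr_gt0.
    have [e_le1 e_le2] : e <= avg v S X - \sum_(k < size (Wint v)) g k j /\
      e <= ilen (Wk v k) - \sum_t g k t by rewrite /e !ge_min !lexx orbT.
    pose r t := g k t + (t == j)%:R * e.
    have sum_r : \sum_t r t = \sum_t g k t + e by rewrite big_split /= sum_delta.
    have: is_flow v S X (set_row g k r).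
      apply: is_flow_set_row => //.
      - by move=> t; rewrite addr_ge0 ?mulr_ge0 // ltW.
      - move=> t; rewrite /r; have [->//|_] := eqVneq t j.
        by rewrite mul0r addr0 => /g_supp[].
      - by rewrite sum_r; lra.
      - move=> t; rewrite /r addrA subrK; have [->|_] := eqVneq t j.
          by rewrite mul1r; lra.
        by rewrite mul0r addr0.
    move/max_g; rewrite flow_value_set_row // sum_r; lra.
  rewrite -full [RHS](bigID (mem T)) /= [X in _ + X]big1 ?addr0 //.
  move=> t Tt; apply/eqP/negPn/negP => gkt.
  have [_ _ St des_t] := g_supp _ _ gkt.
  have neq_tj : t != j by apply: contraNneq Tt => ->.
  have gkt_gt0 : 0 < g k t by rewrite lt_def gkt g_ge0.
  (* Shift [e] from [t] to [j] at interval [k]. The value is unchanged; half the slack leaves [j]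
     unsaturated, while [t] becomes unsaturated, so the new maximum flow has a larger set [U]. *)
  pose e := Num.min ((avg v S X - \sum_(k < size (Wint v)) g k j) / 2) (g k t).
  have e_gt0 : 0 < e by rewrite lt_min gkt_gt0 andbT divr_gt0 ?slack.
  have [e_le1 e_le2] : e <= (avg v S X - \sum_(k < size (Wint v)) g k j) / 2 /\
    e <= g k t by rewrite /e !ge_min !lexx orbT.
  pose r s := g k s + (s == j)%:R * e - (s == t)%:R * e.
  have sum_r : \sum_s r s = \sum_s g k s.
    by rewrite sumrB big_split /= !sum_delta addrK.
  have slack_j := slack _ Tj.
  have rj : r j = g k j + e by rewrite /r eqxx eq_sym (negPf neq_tj) mul1r mul0r subr0.
  have rt : r t = g k t - e by rewrite /r eqxx (negPf neq_tj) mul1r mul0r addr0.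
  have r_other s : s != j -> s != t -> r s = g k s.
    by move=> /negPf sj /negPf st; rewrite /r sj st !mul0r subr0 addr0.
  have flow_h : is_flow v S X (set_row g k r).
    apply: is_flow_set_row => //.
    - move=> s; have [->|sj] := eqVneq s j; first by rewrite rj addr_ge0 // ltW.
      have [->|st] := eqVneq s t; first by rewrite rt subr_ge0.
      by rewrite r_other.
    - move=> s; have [->//|sj] := eqVneq s j; have [->//|st] := eqVneq s t.
      by rewrite r_other // => /g_supp[].
    - by rewrite sum_r.
    - move=> s; have [->|sj] := eqVneq s j; first by rewrite rj; lra.
      have [->|st] := eqVneq s t; first by have := g_col t; rewrite rt; lra.
      by rewrite r_other // subrK.
  have max_h : is_maxflow v S X (set_row g k r).
    by split=> // h /max_g; rewrite flow_value_set_row // sum_r subrK.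
  have := Ug_max _ max_h; rewrite leqNgt => /negP; apply.
  apply: proper_card; apply/properP; split; last first.
    exists t => //; rewrite inE St (sum_set_row g r (fun r => r t)) // rt.
    by have := g_col t; lra.
  apply/subsetP => s; rewrite !inE => /andP[-> lt_s] /=.
  rewrite (sum_set_row g r (fun r => r s)) //.
  have [->|sj] := eqVneq s j; first by rewrite rj; lra.
  have [st|st] := eqVneq s t; first by rewrite st rt; move: lt_s; rewrite st; lra.
  by rewrite r_other // subrK.
(* Minimality says [avg v S X * #|T| <= Len v T X]. But [Len v T X] is part of the flow into [T],
   all of whose agents receive less than [avg v S X]. *)
have := min_S _ T0 TS; rewrite {2}/avg ler_pdivlMr ?ltr0n ?card_gt0 //.
apply/negP; rewrite -ltNge.
have -> : Len v T X = \sum_(k < size (Wint v) | D v T X k) \sum_(j in T) g k j.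
  by apply: eq_bigr => k /row_full.
apply: (@le_lt_trans _ _ (\sum_(j in T) \sum_(k < size (Wint v)) g k j)).
  rewrite [leRHS]exchange_big /= [leRHS](bigID (fun k : 'I__ => D v T X k)) /=.
  by rewrite lerDl sumr_ge0 // => k _; rewrite sumr_ge0.
rewrite mulr_natr -sumr_const; have [j Tj] := set0Pn _ T0.
apply: (ltr_sum_set (j := j)) => //.
by rewrite -subr_gt0 slack.
Qed.

(** * Cut points and the pieces between them *)

Lemma count_le1 (T : eqType) (a : pred T) (s : seq T) :
  uniq s -> {in s &, forall x y, a x -> a y -> x = y} -> (count a s <= 1)%N.
Proof.
move=> /(filter_uniq a) + eq_a; rewrite -size_filter.
case E: (filter a s) => [|x [|y t]] //= /andP[+ _]; rewrite inE negb_or => /andP[/eqP].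
have: x \in filter a s by rewrite E mem_head.
have: y \in filter a s by rewrite E !inE eqxx orbT.
by rewrite !mem_filter => /andP[ay sy] /andP[ax sx]; case; apply: eq_a.
Qed.

Lemma cuts_sorted (R : realType) (n : nat) (v : profile R n) : sorted <=%R (cuts v).
Proof. exact: (sort_sorted le_total). Qed.

Lemma mem_cuts (R : realType) (n : nat) (v : profile R n) (j : 'I_n) (J : R * R) :
  J \in v j -> (J.1 \in cuts v) && (J.2 \in cuts v).
Proof.
move=> vJ; rewrite !mem_sort !mem_undup.
have ends x : x \in [:: J.1; J.2] -> x \in 0 :: 1 :: flatten
    [seq flatten [seq [:: iv.1; iv.2] | iv <- v j] | j <- enum 'I_n].
  move=> Jx; rewrite 2!in_cons; apply/orP; right; apply/orP; right.
  apply/flattenP; exists (flatten [seq [:: iv.1; iv.2] | iv <- v j]).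
    by apply/map_f; rewrite mem_enum.
  apply/flattenP; exists [:: J.1; J.2] => //.
  by apply/mapP; exists J.
by rewrite !ends // !inE eqxx ?orbT.
Qed.

Lemma Wk_nth (R : realType) (n : nat) (v : profile R n) (k : nat) :
  (k < size (Wint v))%N ->
  Wk v k = ((cuts v)`_k, (cuts v)`_k.+1) /\ (k.+1 < size (cuts v))%N.
Proof.
rewrite /Wk /Wint => lt_k; rewrite nth_zip_cond lt_k nth_behead; split=> //.
by move: lt_k; rewrite size_zip size_behead; case: (cuts v) => //= _ s;
   rewrite leq_min ltnS => /andP[].
Qed.

Lemma cuts_leq_nth (R : realType) (n : nat) (v : profile R n) (k m : nat) :
  (k <= m)%N -> (m < size (cuts v))%N -> (cuts v)`_k <= (cuts v)`_m.
Proof.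
move=> le_km lt_m.
by apply: (sorted_leq_nth le_trans lexx) => //; rewrite ?cuts_sorted // inE;
   apply: leq_ltn_trans lt_m.
Qed.

Lemma Wk_cuts (R : realType) (n : nat) (v : profile R n) (k : nat) :
  (k < size (Wint v))%N ->
  [/\ (Wk v k).1 \in cuts v, (Wk v k).2 \in cuts v & (Wk v k).1 <= (Wk v k).2].
Proof.
case/Wk_nth => -> lt_k; split; first by rewrite mem_nth // ltnW.
  by rewrite mem_nth.
by rewrite /= cuts_leq_nth.
Qed.

Lemma Wk_inj (R : realType) (n : nat) (v : profile R n) (x : R) (k m : nat) :
  (k < size (Wint v))%N -> (m < size (Wint v))%N ->
  mem_ivl x (Wk v k) -> mem_ivl x (Wk v m) -> k = m.
Proof.
wlog: k m / (k <= m)%N => [Hwlog Hk Hm Kx Mx|].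
  by have [/Hwlog->//|/ltnW /Hwlog->] := leqP k m.
rewrite leq_eqVlt => /orP[/eqP//|lt_km] /Wk_nth[-> _] /Wk_nth[-> lt_m].
rewrite /mem_ivl /= => /andP[_ lt_x] /andP[le_x _].
have := cuts_leq_nth lt_km (ltnW lt_m).
by rewrite leNgt (le_lt_trans le_x lt_x).
Qed.

(** The piece ends at the first cut beyond [x], of index [k] in the proof. The cut [J.2] is beyond
    [x], hence not before index [k]; the cut [J.1] is at most [x], hence before it, so [k] is
    positive and the piece has index [k.-1]. *)
Lemma Wk_locate (R : realType) (n : nat) (v : profile R n) (x : R) (J : R * R) :
  J.1 \in cuts v -> J.2 \in cuts v -> mem_ivl x J ->
  exists k, [/\ (k < size (Wint v))%N, mem_ivl x (Wk v k),
                J.1 <= (Wk v k).1 & (Wk v k).2 <= J.2].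
Proof.
move=> cJ1 cJ2 /andP[le_x lt_x].
have [a lt_a Ja] := nthP 0 cJ1; have [b lt_b Jb] := nthP 0 cJ2.
have has_gt : has (> x) (cuts v) by apply/hasP; exists J.2.
set k := find (> x) (cuts v).
have lt_k : (k < size (cuts v))%N by rewrite -has_find.
have x_lt : x < (cuts v)`_k := nth_find 0 has_gt.
have lt_ak : (a < k)%N.
  rewrite ltnNge; apply/negP => /cuts_leq_nth /(_ lt_a).
  by rewrite Ja leNgt (le_lt_trans le_x x_lt).
have lt_kb : (k <= b)%N.
  by rewrite leqNgt; apply/negP => /(before_find 0); rewrite Jb lt_x.
have kE : k = k.-1.+1 by rewrite (ltn_predK lt_ak).
have k_lt : (k.-1 < size (Wint v))%N.
  rewrite size_zip size_behead leq_min -kE (ltnW lt_k) -ltnS prednK //.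
  exact: leq_ltn_trans lt_k.
have x_ge : (cuts v)`_k.-1 <= x.
  by rewrite leNgt (@before_find _ 0 (> x)) // -/k [ltnRHS]kE.
exists k.-1; have [-> _] := Wk_nth k_lt; rewrite /mem_ivl /= -kE x_ge x_lt.
split=> //; [by rewrite kE | | by rewrite -Jb cuts_leq_nth].
rewrite -Ja; apply: cuts_leq_nth; last by apply: leq_ltn_trans lt_k; apply: leq_pred.
by rewrite -ltnS prednK //; apply: leq_ltn_trans lt_ak.
Qed.

(** Support endpoints are cuts, so a support interval that meets a piece contains it. One point of a
    piece thus decides whether an agent desires it. *)
Lemma desires_mem (R : realType) (n : nat) (v : profile R n) (x : R) (k : nat)
    (j : 'I_n) :
  (k < size (Wint v))%N -> mem_ivl x (Wk v k) ->
  desires v j (Wk v k) = in_supp (v j) x.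
Proof.
move=> lt_k kx; have /andP[le_x lt_x] := kx; apply/asboolP/idP => [[_]|].
  exact.
case/hasP => J vJ Jx; split; first exact: le_lt_trans lt_x.
move=> y le_y lt_y; have /andP[cJ1 cJ2] := mem_cuts vJ.
have [m [lt_m mx le_m ge_m]] := Wk_locate cJ1 cJ2 Jx.
rewrite -(Wk_inj lt_k lt_m kx mx) in le_m ge_m.
by apply/hasP; exists J => //; rewrite (le_trans le_m) //= (lt_le_trans lt_y).
Qed.

(** * The measure of a union of supports *)

Definition covered (R : realType) (n : nat) (v : profile R n) (T : {set 'I_n}) (x : R) :
  bool := [exists j in T, in_supp (v j) x].

(** A covered point lies in exactly one piece, and that piece is desired by [T]; an uncovered point
    lies in no desired piece. *)
Lemma covered_W (R : realType) (n : nat) (v : profile R n) (T : {set 'I_n}) (x : R) :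
  \sum_(k < size (Wint v) | D v T xpredT k) (mem_ivl x (Wk v k))%:R =
  (covered v T x)%:R :> R.
Proof.
have [/exists_inP[j Tj jx]|/exists_inPn Ncov] := boolP (covered v T x).
  have /hasP[J vJ Jx] := jx; have /andP[cJ1 cJ2] := mem_cuts vJ.
  have [k [lt_k kx _ _]] := Wk_locate cJ1 cJ2 Jx.
  rewrite (bigD1 (Ordinal lt_k)) /=; last first.
    by rewrite /D lt_k; apply/asboolP; exists j => //; rewrite (desires_mem _ lt_k kx).
  rewrite kx big1 ?addr0 // => m /andP[_ neq_m].
  have [mx|//] := boolP (mem_ivl x (Wk v m)).
  by case/eqP: neq_m; apply: val_inj; apply: (Wk_inj (ltn_ord m) lt_k mx kx).
rewrite big1 // => k /and3P[_ _ /asboolP[j Tj des_j]].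
have [kx|//] := boolP (mem_ivl x (Wk v k)).
by have /negP[] := Ncov j Tj; rewrite -(desires_mem _ (ltn_ord k) kx).
Qed.

(** The right-hand side refers to the profile only through its supports, so lengths computed with
    different cuts become comparable over a common [s]. *)
Lemma Len_covered (R : realType) (n : nat) (v : profile R n) (T : {set 'I_n})
    (s : seq R) :
  sorted <=%R s -> {subset cuts v <= s} ->
  Len v T xpredT = stepint s (fun x => (covered v T x)%:R).
Proof.
move=> Hs sub_s; rewrite -(stepint_eq _ (covered_W v T)) -stepint_sum.
apply: eq_bigr => k _; have [c1 c2 le_k] := Wk_cuts (ltn_ord k).
by rewrite stepint_ivl // sub_s.
Qed.

(** * Desired lengths and averages in successive rounds *)

Lemma Len_eq (R : realType) (n : nat) (v : profile R n) (T : {set 'I_n})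
    (X Y : nat -> bool) :
  (forall k, (k < size (Wint v))%N -> X k = Y k) -> Len v T X = Len v T Y.
Proof. by move=> eqXY; apply: eq_bigl => k; rewrite /D eqXY. Qed.

Lemma D_setU (R : realType) (n : nat) (v : profile R n) (S T : {set 'I_n})
    (X : nat -> bool) (k : nat) :
  D v (S :|: T) X k = D v S X k || D v T X k.
Proof.
rewrite /D -!andb_orr; congr [&& _, _ & _]; apply/asboolP/orP.
  by case=> j; rewrite inE => /orP[] jS des_j; [left|right]; apply/asboolP; exists j.
by case=> /asboolP[j jS des_j]; exists j; rewrite // inE jS ?orbT.
Qed.

Lemma Len_setU (R : realType) (n : nat) (v : profile R n) (S T : {set 'I_n})
    (X : nat -> bool) :
  Len v (S :|: T) X = Len v S X + Len v T (fun k => X k && ~~ D v S X k).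
Proof.
rewrite /Len (bigID (fun k : 'I__ => D v S X k)) /=; congr (_ + _); apply: eq_bigl => k.
  by rewrite D_setU; case: (D v S X k); rewrite ?orbT ?andbF.
by rewrite D_setU andb_orl andbN /= {1 3}/D /=; case: (D v S X k); rewrite ?andbF ?andbT.
Qed.

(** The average of the union of [S'] and [T] on [X] is a weighted mean of the two averages compared
    here. By minimality of [S'] this mean is at least [avg v S' X], so the other average is too. *)
Lemma avg_next_ge (R : realType) (n : nat) (v : profile R n) (S S' T : {set 'I_n})
    (X : nat -> bool) :
  S' != set0 -> S' \subset S ->
  (forall T : {set 'I_n}, T != set0 -> T \subset S -> avg v S' X <= avg v T X) ->
  T != set0 -> T \subset S :\: S' ->
  avg v S' X <= avg v T (fun k => X k && ~~ D v S' X k).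
Proof.
move=> S'0 S'S min_S' T0; rewrite subsetD => /andP[TS disjT].
have U0 : S' :|: T != set0 by rewrite setU_eq0 negb_and S'0.
have := min_S' _ U0; rewrite subUset S'S TS => /(_ isT).
rewrite /avg Len_setU cardsU disjoint_setI0 1?disjoint_sym // cards0 subn0 natrD.
have s_gt0 : 0 < #|S'|%:R :> R by rewrite ltr0n card_gt0.
have t_gt0 : 0 < #|T|%:R :> R by rewrite ltr0n card_gt0.
rewrite ler_pdivlMr ?addr_gt0 // mulrDr divfK ?gt_eqF // lerD2l.
by rewrite ler_pdivlMr.
Qed.

(** * The invariant of a run *)

Definition total_len (R : realType) (P : seq (R * R)) : R := \sum_(J <- P) ilen J.

(** [inv_avg] makes the lengths handed out nondecreasing over the rounds, and [inv_tight] is the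
    exhaustion of supports on sublevel sets. [inv_used] places old pieces in intervals already
    removed from [X], which keeps later pieces disjoint from them. *)
Record run_inv (R : realType) (n : nat) (v : profile R n) (S : {set 'I_n})
    (X : nat -> bool) (P : 'I_n -> seq (R * R)) : Prop := RunInv {
  inv_rest : forall k, (k < size (Wint v))%N -> X k = ~~ D v (~: S) xpredT k;
  inv_nil : forall j, j \in S -> P j = [::];
  inv_avg : forall j T, j \notin S -> T != set0 -> T \subset S ->
    total_len (P j) <= avg v T X;
  inv_tight : forall c A, A = [set j | (j \notin S) && (total_len (P j) <= c)] ->
    Len v A xpredT <= \sum_(j in A) total_len (P j);
  inv_ivl : forall j J, J \in P j -> J.1 <= J.2;
  inv_supp : forall j x, in_supp (P j) x -> in_supp (v j) x;
  inv_used : forall j x, in_supp (P j) x ->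
    exists k, [/\ (k < size (Wint v))%N, ~~ X k & mem_ivl x (Wk v k)];
  inv_once : forall j x, (count (mem_ivl x) (P j) <= 1)%N;
  inv_excl : forall j j' x, in_supp (P j) x -> in_supp (P j') x -> j = j' }.

Lemma run_inv_init (R : realType) (n : nat) (v : profile R n) :
  run_inv v [set: 'I_n] (fun _ => true) (fun _ => [::]).
Proof.
split=> //.
- move=> k _; rewrite setCT; apply/esym/negP => /and3P[_ _ /asboolP[j]].
  by rewrite inE.
- by move=> j T; rewrite inE.
- move=> c A AE; have -> : A = set0 by rewrite AE; apply/setP => j; rewrite !inE.
  by rewrite /Len big_set0 big1 // => k /and3P[_ _ /asboolP[j]]; rewrite inE.
Qed.

(** Each agent of [S'] receives [avg v S' X], at least as much as anyone served before. A sublevel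
    set at a smaller level is therefore one from the previous state, and at any other level it
    consists of all agents served so far. *)
Lemma run_inv_round (R : realType) (n : nat) (v : profile R n) (S S' : {set 'I_n})
    (X : nat -> bool) (P : 'I_n -> seq (R * R)) (f : nat -> 'I_n -> R)
    (p : nat -> 'I_n -> R * R) :
  S' != set0 -> S' \subset S ->
  (forall T : {set 'I_n}, T != set0 -> T \subset S -> avg v S' X <= avg v T X) ->
  is_maxflow v S' X f -> valid_place v f p ->
  run_inv v S X P ->
  run_inv v (S :\: S') (fun k => X k && ~~ D v S' X k)
    (fun j => if j \in S' then [seq p k j | k <- iota 0 (size (Wint v)) & D v S' X k]
              else P j).
Proof.
move=> S'0 S'S min_S' max_f place_p inv.
have [Xrest Pnil Pavg Ptight Pivl Psupp Pused Ponce Pexcl] := inv.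
have [f_ge0 f_supp _ _ _] := max_f.1.
have CS : ~: (S :\: S') = ~: S :|: S' by rewrite setCD.
set new := fun j => [seq p k j | k <- iota 0 (size (Wint v)) & D v S' X k].
have in_new j x : in_supp (new j) x -> exists k,
    [/\ (k < size (Wint v))%N, D v S' X k & mem_ivl x (p k j)].
  case/hasP => J /mapP[k]; rewrite mem_filter mem_iota => /andP[Dk /= lt_k] -> kx.
  by exists k.
have p_W k j x : (k < size (Wint v))%N -> mem_ivl x (p k j) -> mem_ivl x (Wk v k).
  move=> lt_k /andP[le_x lt_x]; have [/(_ j)[le1 le2 _] _] := place_p k lt_k.
  by rewrite /mem_ivl (le_trans le1) // (lt_le_trans lt_x).
have new_len j : j \in S' -> total_len (new j) = avg v S' X.
  move=> jS'; rewrite -(maxflow_saturates max_f _ jS'); last first.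
    by move=> T T0 TS'; apply: min_S' => //; apply: subset_trans S'S.
  rewrite /total_len big_map big_filter -[size _]subn0 big_mkord subn0 big_mkcond /=.
  apply: eq_bigr => k _; have [/(_ j)[_ _ ->] _] := place_p k (ltn_ord k).
  case: ifPn => // NDk; apply/esym/eqP; apply: contraNT NDk => /f_supp[lt_k Xk _ des].
  by apply/and3P; split=> //; apply/asboolP; exists j.
have le_avg j : j \notin S -> total_len (P j) <= avg v S' X.
  by move=> jS; apply: Pavg.
have notin_next j : j \notin S :\: S' -> (j \in S') || (j \notin S).
  by rewrite inE negb_and negbK.
split.
- by move=> k lt_k; rewrite CS D_setU negb_or -Xrest // /D; case: (X k); rewrite ?andbF.
- move=> j; rewrite inE => /andP[/negPf-> jS]; exact: Pnil.
- move=> j T /notin_next jS T0 TS; apply: le_trans (avg_next_ge S'0 S'S min_S' T0 TS).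
  by case: ifPn jS => [jS' _|_ /= jS]; [rewrite new_len | apply: le_avg].
- move=> c A ->; have [lt_c|le_c] := ltP c (avg v S' X).
    set A' := [set j | _]; have AE : A' = [set j | (j \notin S) && (total_len (P j) <= c)].
      apply/setP => j; rewrite !inE; case: ifPn => [jS'|jS' //].
      by rewrite new_len // leNgt lt_c (subsetP S'S) ?andbF.
    rewrite AE; apply: le_trans (Ptight c _ erefl) _; apply: ler_sum => j.
    by rewrite inE => /andP[jS _]; rewrite ifN //; apply: contra jS; apply: (subsetP S'S).
  set A' := [set j | _]; have AE : A' = ~: S :|: S'.
    apply/setP => j; rewrite !inE; case: ifPn => [jS'|jS'].
      by rewrite new_len // le_c andbT orbT.
    rewrite orbF; have [//|jS] := boolP (j \in S).
    by rewrite (le_trans (le_avg _ jS)).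
  (* The part desired by earlier agents is bounded by the old tightness; the rest is [Len v S' X],
     which equals [#|S'|] times the average. *)
  rewrite AE Len_setU (bigID (mem S')) /= [leLHS]addrC; apply: lerD.
    rewrite (eq_bigr (fun=> avg v S' X)); last first.
      by move=> j /andP[_ jS']; rewrite jS' new_len.
    rewrite (eq_bigl (mem S')); last by move=> j; rewrite !inE andbC orKb.
    rewrite sumr_const -mulr_natr /avg divfK ?pnatr_eq0 ?cards_eq0 //.
    rewrite le_eqVlt; apply/orP; left; apply/eqP; apply: Len_eq => k lt_k.
    by rewrite Xrest.
  have := Ptight c _ erefl; rewrite (_ : [set j | _] = ~: S); last first.
    apply/setP => j; rewrite !inE; have [//|jS] := boolP (j \in S).
    by rewrite (le_trans (le_avg _ jS)).
  move/le_trans; apply; rewrite le_eqVlt; apply/orP; left; apply/eqP.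
  apply: eq_big => j; last first.
    by rewrite inE => jS; rewrite ifN //; apply: contra jS; apply: (subsetP S'S).
  rewrite !inE; have [/(subsetP S'S)->//|] := boolP (j \in S'); by rewrite orbF andbT.
- move=> j J; case: ifPn => _; last exact: Pivl.
  case/mapP => k; rewrite mem_filter mem_iota => /andP[_ /= lt_k] ->.
  have [/(_ j)[_ _ len_p] _] := place_p k lt_k.
  by rewrite -subr_ge0 -/(ilen _) len_p.
- move=> j x; case: ifPn => _; last exact: Psupp.
  case/in_new => k [lt_k Dk kx]; have [/(_ j)[_ _ len_p] _] := place_p k lt_k.
  (* A placed piece containing a point has positive length, hence carries flow, and flow reaches
     only agents that desire the interval. *)
  rewrite -(desires_mem _ lt_k (p_W _ _ _ lt_k kx)).
  have /f_supp[] // : f k j != 0.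
  by rewrite -len_p /ilen subr_eq0 gt_eqF //; case/andP: kx => /le_lt_trans; apply.
- move=> j x; case: ifPn => _.
    case/in_new => k [lt_k Dk /p_W kx]; exists k; split=> //; last exact: kx.
    by rewrite Dk andbF.
  by case/Pused => k [lt_k NXk kx]; exists k; rewrite (negPf NXk).
- move=> j x; case: ifPn => _; last exact: Ponce.
  rewrite count_map; apply: count_le1; first by rewrite filter_uniq ?iota_uniq.
  move=> k m; rewrite !mem_filter !mem_iota /= => /andP[_ lt_k] /andP[_ lt_m] /= kx mx.
  by apply: Wk_inj (p_W _ _ _ lt_k kx) (p_W _ _ _ lt_m mx).
(* Old pieces lie in intervals outside [X], new ones in intervals of [X], and a point determines its
   interval. *)
- have old_new j j' x : in_supp (P j) x -> in_supp (new j') x -> False.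
    case/Pused => k [lt_k NXk kx] /in_new[m [lt_m /and3P[_ Xm _] /p_W mx]].
    by rewrite (Wk_inj lt_k lt_m kx (mx lt_m)) Xm in NXk.
  move=> j j' x; case: ifPn => _; case: ifPn => _.
  + case/in_new => k [lt_k _ kx] /in_new[m [lt_m _ mx]].
    move: (mx); rewrite -(Wk_inj lt_k lt_m (p_W _ _ _ lt_k kx) (p_W _ _ _ lt_m mx)).
    move=> k'x; apply/eqP/negPn/negP => neq_j.
    have [_ /(_ j j' neq_j) disj] := place_p k lt_k.
    case/andP: kx => a1 a2; case/andP: k'x => b1 b2.
    by case: disj => disj; move: a1 a2 b1 b2 disj; lra.
  + by move=> h1 h2; case: (old_new _ _ _ h2 h1).
  + by move=> h1 h2; case: (old_new _ _ _ h1 h2).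
  + exact: Pexcl.
Qed.

Lemma run_inv_iter (R : realType) (n : nat) (v : profile R n) (ru : CCrules R n)
    (m : nat) :
  valid_rules ru ->
  let st := iter m (CC_step ru v) ([set: 'I_n], (fun _ => true), (fun _ => [::])) in
  run_inv v st.1.1 st.1.2 st.2 /\ (#|st.1.1| <= n - m)%N.
Proof.
move=> Hru; elim: m => [|m].
  by split; [exact: run_inv_init | rewrite cardsT card_ord subn0].
rewrite iterS; case: (iter m _ _) => [[S X] P] /= [inv le_S]; rewrite /CC_step.
have [S0|S0] := eqVneq S set0; first by split; rewrite // S0 cards0.
have [S'0 S'S min_S' max_f place_p] := Hru v S X S0; split.
  exact: (run_inv_round S'0 S'S min_S' max_f place_p inv).
by rewrite /= cardsD (setIidPr S'S) subnS -subn1 leq_sub ?card_gt0.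
Qed.

Lemma CC_puv_inv (R : realType) (n : nat) (v : profile R n) (ru : CCrules R n) :
  valid_rules ru -> exists X, run_inv v set0 X (CC_puv ru v).
Proof.
move=> Hru; have /= := run_inv_iter v n Hru; rewrite subnn leqn0 cards_eq0.
by rewrite /CC_puv; case: (iter n _ _) => [[S X] P] /= [inv /eqP S0]; exists X; rewrite -S0.
Qed.

(** * Lengths and values of allocations as integrals *)

Lemma sum_mem_ivl (R : realType) (P : seq (R * R)) (x : R) :
  (count (mem_ivl x) P <= 1)%N ->
  \sum_(J <- P) (mem_ivl x J)%:R = (in_supp P x)%:R :> R.
Proof.
rewrite -natr_sum -big_mkcond sum1_count /in_supp has_count.
by case: count => [|[|]].
Qed.

Lemma total_len_stepint (R : realType) (s : seq R) (P : seq (R * R)) :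
  sorted <=%R s ->
  {in P, forall J : R * R, [/\ J.1 \in s, J.2 \in s & J.1 <= J.2]} ->
  (forall x, (count (mem_ivl x) P <= 1)%N) ->
  total_len P = stepint s (fun x => (in_supp P x)%:R).
Proof.
move=> Hs ends once; rewrite -(stepint_eq _ (fun x => sum_mem_ivl (once x))).
rewrite -stepint_sum; apply: eq_big_seq => J /ends[J1 J2 le_J].
by rewrite stepint_ivl.
Qed.

(** The intersection is again a half-open interval with ends in [s]; when its ends are reversed,
    both sides vanish. *)
Lemma overlap_stepint (R : realType) (s : seq R) (J K : R * R) :
  sorted <=%R s -> J.1 \in s -> J.2 \in s -> K.1 \in s -> K.2 \in s ->
  overlap J K = stepint s (fun x => (mem_ivl x J && mem_ivl x K)%:R).
Proof.
move=> Hs J1 J2 K1 K2; pose I := (Num.max J.1 K.1, Num.min J.2 K.2).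
have memI x : mem_ivl x J && mem_ivl x K = mem_ivl x I.
  by rewrite /mem_ivl ge_max lt_min andbACA.
rewrite (stepint_eq _ (fun x => congr1 (fun b : bool => b%:R) (memI x))).
rewrite /overlap; have [le_I|lt_I] := leP I.1 I.2.
  rewrite stepint_ivl //; last 2 first.
  - by rewrite /I /= maxEle; case: ifP.
  - by rewrite /I /= minEle; case: ifP.
  by rewrite /ilen max_r // subr_ge0.
rewrite max_l ?subr_le0 ?ltW // -(stepint0 s); apply: stepint_eq => x.
case: (boolP (mem_ivl x I)) => // /andP[le_x lt_x].
by have := lt_trans lt_I (le_lt_trans le_x lt_x); rewrite ltxx.
Qed.

Lemma sum_overlap_stepint (R : realType) (s : seq R) (P Q : seq (R * R)) :
  sorted <=%R s ->
  {in P, forall J : R * R, (J.1 \in s) && (J.2 \in s)} ->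
  {in Q, forall J : R * R, (J.1 \in s) && (J.2 \in s)} ->
  (forall x, (count (mem_ivl x) P <= 1)%N) ->
  (forall x, (count (mem_ivl x) Q <= 1)%N) ->
  \sum_(J <- P) \sum_(K <- Q) overlap J K =
    stepint s (fun x => (in_supp P x && in_supp Q x)%:R).
Proof.
move=> Hs endsP endsQ onceP onceQ.
transitivity (stepint s (fun x =>
    \sum_(J <- P) \sum_(K <- Q) (mem_ivl x J && mem_ivl x K)%:R)).
  rewrite -stepint_sum; apply: eq_big_seq => J /endsP/andP[J1 J2].
  rewrite -stepint_sum; apply: eq_big_seq => K /endsQ/andP[K1 K2].
  by rewrite -overlap_stepint.
apply: stepint_eq => x; rewrite -mulnb natrM -!sum_mem_ivl // mulr_suml.
apply: eq_bigr => J _; rewrite mulr_sumr; apply: eq_bigr => K _.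
by rewrite -mulnb natrM.
Qed.

(** Pieces of different agents are disjoint, so at each point at most one term is nonzero, and only
    if the point is covered by [A]. *)
Lemma sum_stepint_covered (R : realType) (n : nat) (v : profile R n) (s : seq R)
    (P : 'I_n -> seq (R * R)) (A : {set 'I_n}) :
  sorted <=%R s ->
  (forall j j' x, in_supp (P j) x -> in_supp (P j') x -> j = j') ->
  \sum_(j in A) stepint s (fun x => (in_supp (P j) x && in_supp (v j) x)%:R) <=
  stepint s (fun x => (covered v A x)%:R).
Proof.
move=> Hs excl; rewrite stepint_sum; apply: stepint_le => // x.
have [/exists_inP[j Aj /andP[Pj vj]]|/exists_inPn none] :=
  boolP [exists j in A, in_supp (P j) x && in_supp (v j) x].
  rewrite (bigD1 j) //= Pj vj big1 ?addr0 => [|k /andP[_ neq_k]].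
    by have -> : covered v A x by apply/exists_inP; exists j.
  have [Pk|//] := boolP (in_supp (P k) x).
  by rewrite (excl _ _ _ Pk Pj) eqxx in neq_k.
by rewrite big1 ?ler0n // => j /none /negPf->.
Qed.

(** * Strategyproofness of the allocation algorithm *)

(** [level_tight_le] is applied to the true worths of the runs on [v] and on [w]. Worth equals
    length, except for [i] in the second run, where it is at most the length. Supports are compared
    pointwise because a misreport can change how much padding the other lists keep. *)
Lemma CC_puv_strategyproof (R : realType) (n : nat) (ru : CCrules R n)
    (v w : profile R n) (i : 'I_n) (s : seq R) :
  valid_rules ru -> (forall j, j != i -> in_supp (w j) =1 in_supp (v j)) -> sorted <=%R s ->
  {subset cuts v <= s} -> {subset cuts w <= s} ->
  {subset cuts (CC_puv ru v) <= s} -> {subset cuts (CC_puv ru w) <= s} ->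
  stepint s (fun x => (in_supp (CC_puv ru w i) x && in_supp (v i) x)%:R) <=
  stepint s (fun x => (in_supp (CC_puv ru v i) x && in_supp (v i) x)%:R).
Proof.
move=> Hru wv Hs sub_v sub_w sub_P sub_Q.
have [X invP] := CC_puv_inv v Hru; have [Y invQ] := CC_puv_inv w Hru.
move: invP invQ sub_P sub_Q; move: (CC_puv ru v) (CC_puv ru w) => P Q.
move=> [_ _ _ tightP ivlP suppP _ onceP exclP] [_ _ _ tightQ ivlQ suppQ _ onceQ exclQ].
move=> sub_P sub_Q.
pose worth (A : 'I_n -> seq (R * R)) j :=
  stepint s (fun x => (in_supp (A j) x && in_supp (v j) x)%:R).
rewrite -/(worth Q i) -/(worth P i).
have lenP j : total_len (P j) = stepint s (fun x => (in_supp (P j) x)%:R).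
  apply: total_len_stepint => // J PJ; have /andP[J1 J2] := mem_cuts PJ.
  by rewrite !sub_P // (ivlP j).
have lenQ j : total_len (Q j) = stepint s (fun x => (in_supp (Q j) x)%:R).
  apply: total_len_stepint => // J QJ; have /andP[J1 J2] := mem_cuts QJ.
  by rewrite !sub_Q // (ivlQ j).
have worthP j : worth P j = total_len (P j).
  rewrite lenP; apply: stepint_eq => x; have := suppP j x.
  by case: (in_supp (P j) x) => //= ->.
have worthQ j : j != i -> worth Q j = total_len (Q j).
  move=> /wv wvj; rewrite lenQ; apply: stepint_eq => x; have := suppQ j x.
  by rewrite wvj; case: (in_supp (Q j) x) => //= ->.
have worthQ_le : worth Q i <= total_len (Q i).
  rewrite lenQ; apply: stepint_le => // x.
  by case: (in_supp (Q i) x); rewrite ?ler01 ?lexx //=; case: in_supp.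
pose cap (A : {set 'I_n}) := stepint s (fun x => (covered v A x)%:R : R).
apply: (level_tight_le (cap := cap)).
- by move=> A; apply: sum_stepint_covered.
- by move=> A; apply: sum_stepint_covered.
- move=> c; rewrite /cap -Len_covered // (eq_bigr _ (fun j _ => worthP j)).
  by apply: (tightP c); apply/setP => j; rewrite !inE worthP.
- move=> c lt_c; set A := [set j | _].
  have Ai : i \notin A by rewrite inE -ltNge.
  have neq_i j : j \in A -> j != i by apply: contraTneq => ->.
  rewrite (eq_bigr (fun j => total_len (Q j))) => [|j /neq_i/worthQ //].
  (* [A] omits [i], and all other agents have the same support in [v] and [w]. *)
  have -> : cap A = Len w A xpredT.
    rewrite (@Len_covered _ _ w A s) //; apply: stepint_eq => x.
    congr (_%:R); congr nat_of_bool; apply: eq_existsb => j.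
    by have [/neq_i/wv->|] := boolP (j \in A).
  (* Sublevel sets by worth and by length agree: for [i], the worth exceeds [c] and so does the
     length. *)
  apply: (tightQ c); apply/setP => j; rewrite !inE /=.
  have [->|/worthQ->//] := eqVneq j i.
  by rewrite !leNgt lt_c (lt_le_trans lt_c).
Qed.

(** * Valid reports and their padding *)

Lemma valid_report_supp (R : realType) (L : nat) (r : report R) :
  valid_report L r ->
  supp_of r = [seq nth (0, 0) r.2 k | k <- iota 0 r.1].
Proof. by case=> [[/andP[_ le_rL] size_r] _ _ _ _]; rewrite map_nth_iota0 // size_r. Qed.

Lemma valid_report_ordered (R : realType) (L : nat) (r : report R) (k m : nat) :
  valid_report L r -> (k < m < r.1)%N ->
  (nth (0, 0) r.2 k).2 <= (nth (0, 0) r.2 m).1.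
Proof.
case=> _ nonempty gap _ _; elim: m => // m IH /andP[]; rewrite ltnS leq_eqVlt.
case/orP => [/eqP->|lt_km] lt_m; first exact: gap.
apply: le_trans (gap _ lt_m); apply: le_trans (IH _) _; first by rewrite lt_km ltnW.
by have [_ [/ltW]] := nonempty m (ltnW lt_m).
Qed.

Lemma count_supp_of (R : realType) (L : nat) (r : report R) (x : R) :
  valid_report L r -> (count (mem_ivl x) (supp_of r) <= 1)%N.
Proof.
move=> Hr; rewrite (valid_report_supp Hr) count_map.
apply: count_le1; first exact: iota_uniq.
move=> k m; rewrite !mem_iota /= !add0n; wlog: k m / (k <= m)%N => [Hwlog Hk Hm Kx Mx|].
  by have [/Hwlog->//|/ltnW /Hwlog->] := leqP k m.
rewrite leq_eqVlt => /orP[/eqP//|lt_km] _ lt_m /andP[_ lt_x] /andP[le_x _].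
have := @valid_report_ordered _ _ _ k m Hr; rewrite lt_km lt_m => /(_ isT).
by rewrite leNgt (le_lt_trans le_x lt_x).
Qed.

(** The intervals kept beyond the first [r.1] are padding with equal ends, so they contain no
    point. *)
Lemma in_supp_take (R : realType) (L l : nat) (r : report R) (x : R) :
  valid_report L r -> (r.1 <= l)%N -> in_supp (take l r.2) x = in_supp (supp_of r) x.
Proof.
case=> [[_ size_r] _ _ padding _] le_l.
rewrite /supp_of -(cat_take_drop r.1 (take l r.2)) take_takel // /in_supp has_cat.
rewrite [X in _ || X](_ : _ = false) ?orbF //; apply/hasPn => J.
move/(nthP (0, 0)) => [k]; rewrite size_drop size_take_min size_r ltn_subRL leq_min.
case/andP => lt_l lt_L; rewrite nth_drop nth_take //.
move=> <-; have [|_ [ends_eq _]] := padding (r.1 + k)%N.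
  by rewrite leq_addr.
by rewrite /= ends_eq; case: leP.
Qed.

Unset Implicit Arguments.

(** * Strategyproofness of the protocol *)

Theorem theorem2 (R : realType) (n L : nat) (ru : CCrules R n)
  (Hru : valid_rules ru)
  (i : 'I_n) (rep : 'I_n -> report R) (mis : report R) :
  (forall j, valid_report L (rep j)) ->
  valid_report L mis ->
  pu_value (rep i) (PP_CC_puv ru (fun j => if j == i then mis else rep j) i)
    <= pu_value (rep i) (PP_CC_puv ru rep i).
Proof.
move=> valid_rep valid_mis; rewrite /PP_CC_puv.
pose mrep j := if j == i then mis else rep j; rewrite -/mrep.
pose l := \max_j (rep j).1; pose l' := \max_j (mrep j).1; rewrite -/l -/l'.
pose v j := take l (rep j).2; pose w j := take l' (mrep j).2; rewrite -/v -/w.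
have le_l j : ((rep j).1 <= l)%N by apply: (leq_bigmax j).
have le_l' j : ((mrep j).1 <= l')%N by apply: (leq_bigmax j).
have valid_mrep j : valid_report L (mrep j) by rewrite /mrep; case: ifP.
have wv j : j != i -> in_supp (w j) =1 in_supp (v j).
  move=> /negPf ji x; rewrite (in_supp_take _ (valid_mrep j)) //.
  by rewrite (in_supp_take _ (valid_rep j)) // /mrep ji.
(* An allocation has the type of a profile, so [cuts] also collects the ends of the allocated
   pieces. *)
pose s := sort <=%R (cuts v ++ cuts w ++ cuts (CC_puv ru v) ++ cuts (CC_puv ru w)).
have Hs : sorted <=%R s by apply: (sort_sorted le_total).
have mem_s x : (x \in s) = [|| x \in cuts v, x \in cuts w,
    x \in cuts (CC_puv ru v) | x \in cuts (CC_puv ru w)].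
  by rewrite mem_sort !mem_cat.
have sub_v : {subset cuts v <= s} by move=> x; rewrite mem_s => ->.
have sub_w : {subset cuts w <= s} by move=> x; rewrite mem_s => ->; rewrite orbT.
have sub_P : {subset cuts (CC_puv ru v) <= s}.
  by move=> x Px; rewrite mem_s; apply/or4P; apply: Or43.
have sub_Q : {subset cuts (CC_puv ru w) <= s}.
  by move=> x Qx; rewrite mem_s; apply/or4P; apply: Or44.
have value u : {subset cuts (CC_puv ru u) <= s} ->
    \sum_(J <- CC_puv ru u i) \sum_(K <- supp_of (rep i)) overlap J K =
    stepint s (fun x => (in_supp (CC_puv ru u i) x && in_supp (v i) x)%:R).
  move=> sub_u; have [X inv] := CC_puv_inv u Hru.
  rewrite (@sum_overlap_stepint _ s) //.
  - by apply: stepint_eq => x; rewrite (in_supp_take _ (valid_rep i)).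
  - by move=> J /mem_cuts /andP[J1 J2]; rewrite !sub_u.
  (* The true support list is a prefix of [v i], so its ends are cuts of [v]. *)
  - move=> J supp_J; have /mem_cuts/andP[J1 J2] : J \in v i; last by rewrite !sub_v.
    by move: supp_J; rewrite /supp_of -(take_takel _ (le_l i)) => /mem_take.
  - exact: inv_once inv i.
  - by move=> x; apply: count_supp_of (valid_rep i).
(* Both values share the normalizing factor, the inverse of the total support length, which is
   nonnegative. *)
rewrite /pu_value (value v sub_P) (value w sub_Q); apply: ler_wpM2r.
  rewrite invr_ge0 (valid_report_supp (valid_rep i)) big_map big_seq.
  apply: sumr_ge0 => k; rewrite mem_iota /= add0n => lt_k.
  have [_ nonempty _ _ _] := valid_rep i.
  by have [_ [/ltW]] := nonempty k lt_k; rewrite subr_ge0.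
exact: (CC_puv_strategyproof Hru wv Hs sub_v sub_w sub_P sub_Q).
Qed.
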